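(* For every $\varepsilon\in(0,1)$ and $C_q<\infty$ there is a constant $C>0$, depending only on $C_q$ and $\varepsilon$, such that the following holds. Let $\mathcal X$ be a bounded observation space, let $f_0,f_1$ be probability densities on $\mathcal X$, and let $q$ be a probability density on $\mathcal X$ with $|\log q(x)|\le C_q$ for all $x\in\mathcal X$. For $j=0,1$ let $g_j(x)=(1-\varepsilon)f_j(x)+\varepsilon q(x)$. Then for every weight function $w_j:\mathcal X\to[0,1]$, $j=0,1$, and every $x\in\mathcal X$, $$g_j(x)\ \ge\ C\, f_j(x)^{w_j(x)} .$$
   Context: All densities are nonnegative functions, taken with respect to a common reference measure on $\mathcal X$. $f_0$ and $f_1$ are the clean pre- and post-change densities, $q$ is the contamination density and $\varepsilon$ the contamination probability. The convention $0^0=1$ is used. *)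

(* Defs.v *)
From HB Require Import structures.
From mathcomp Require Import all_boot all_order all_algebra.
From mathcomp Require Import all_classical all_reals all_analysis.

Set Implicit Arguments.
Unset Strict Implicit.
Unset Printing Implicit Defensive.
Import Order.TTheory GRing.Theory Num.Theory.
Local Open Scope classical_set_scope.
Local Open Scope ring_scope.

(* No compatibility between the sigma-algebra and the metric topology is
   required: the metric only serves to express boundedness. *)
#[short(type="measMetricType")]
HB.structure Definition MeasMetric (R : realType) (d : measure_display) :=
  { T of Metric R T & Measurable d T }.

Definition bounded_space (R : realType) (d : measure_display)
    (X : measMetricType R d) : Prop :=
  exists M : R, forall x y : X, mdist x y <= M.

Definition is_density (R : realType) (d : measure_display)
    (X : measurableType d) (mu : {measure set X -> \bar R})
    (f : X -> R) : Prop :=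
  [/\ forall x, 0 <= f x,
      measurable_fun [set: X] f &
      (\int[mu]_x (f x)%:E = 1)%E].

Definition contaminated (R : realType) (X : Type) (eps : R) (f q : X -> R)
    (x : X) : R :=
  (1 - eps) * f x + eps * q x.

(* Main.v *)
(* Since 0 <= w <= 1, f^w <= 1 + f; the contamination term eps * q, bounded below
   by eps * exp(-Cq), dominates C * 1 and the clean term dominates C * f. *)
Require Import Defs.
From HB Require Import structures.
From mathcomp Require Import all_boot all_order all_algebra.
From mathcomp Require Import all_classical all_reals all_analysis.

Set Implicit Arguments.
Unset Strict Implicit.
Unset Printing Implicit Defensive.
Import Order.TTheory GRing.Theory Num.Theory.
Local Open Scope classical_set_scope.
Local Open Scope ring_scope.

(** The bound is pointwise. By [powR_le_addr1], [C * f ^ w] is at most [C * f + C]; the clean part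
    [(1 - eps) * f] absorbs [C * f], and [eps * q], kept away from 0 by [abse_lne_expR_le], absorbs
    the constant [C]. *)

Lemma powR_le_addr1 (R : realType) (a w : R) :
  0 <= a -> 0 <= w <= 1 -> a `^ w <= 1 + a.
Proof.
move=> a0 /andP[w0 w1]; have [a1|/ltW a1] := leP a 1.
  have := ge0_ler_powR w0 (_ : a \in Num.nneg) (_ : 1 \in Num.nneg) a1.
  rewrite !nnegrE a0 ler01 powR1 => /(_ isT isT) aw1.
  by rewrite (le_trans aw1) // lerDl.
by rewrite (le_trans (ler1_powR a1 w1)) // lerDr.
Qed.

(** The extended logarithm is -oo for [y <= 0], so a finite bound on its absolute value already
    forces [y > 0]. *)
Lemma abse_lne_expR_le (R : realType) (c y : R) :
  (`|lne y%:E| <= c%:E)%E -> expR (- c) <= y.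
Proof.
have [y0|y0] := leP y 0; first by rewrite le0_lneNy.
rewrite lne_EFin // abse_EFin lee_fin ler_norml => /andP[cy _].
by rewrite -(lnK y0) ler_expR.
Qed.

Theorem proposition1 (R : realType) (eps Cq : R) (heps : 0 < eps < 1) :
  exists2 C : R, 0 < C &
    forall (d : measure_display) (X : measMetricType R d)
      (mu : {measure set X -> \bar R}) (f : 'I_2 -> X -> R) (q : X -> R),
      bounded_space X ->
      (forall j, is_density mu (f j)) ->
      is_density mu q ->
      (forall x, (`|lne (q x)%:E| <= Cq%:E)%E) ->
      forall w : 'I_2 -> X -> R,
      (forall j x, 0 <= w j x <= 1) ->
      forall j x, contaminated eps (f j) q x >= C * f j x `^ w j x.
Proof.
have /andP[e0 e1] := heps; have ee0 := expR_gt0 (- Cq).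
(* The first entry is the coefficient of the clean density, the second the lower bound of
   [eps * q]. *)
exists (Num.min (1 - eps) (eps * expR (- Cq))).
  by rewrite lt_min subr_gt0 e1 mulr_gt0.
move=> d X mu f q _ fd _ qC w w01 j x.
have [f0 _ _] := fd j; have qx := abse_lne_expR_le (qC x).
set C := Num.min _ _.
have C1 : C <= 1 - eps by rewrite ge_min lexx.
have C2 : C <= eps * expR (- Cq) by rewrite ge_min lexx orbT.
have C0 : 0 <= C by rewrite le_min subr_ge0 ltW// mulr_ge0 // ltW.
apply: le_trans (ler_wpM2l C0 (powR_le_addr1 (f0 x) (w01 j x))) _.
(* The sum is reordered to [C * f + C] for a termwise comparison with the mixture. *)
rewrite mulrDr mulr1 addrC /contaminated lerD ?ler_wpM2r //.
by rewrite (le_trans C2) // ler_wpM2l // ltW.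
Qed.
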